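(* For every integer $N\ge 1$, $\mathcal{L}^N\ne\mathcal{L}^{N-}$.
   Context: $\Pi$ is the open upper half plane in $\mathbb{C}$, and $\mathcal{P}_2$ is the set of holomorphic functions from $\Pi^2$ to $\Pi$. Multi-indices $n=(n_1,n_2)$ are pairs of non-negative integers, $|n|=n_1+n_2$, $z^n=z_1^{n_1}z_2^{n_2}$. Nontangential asymptotics: an asymptotic formula holds nontangentially (at $\infty$) if for each $c\in\mathbb{R}$ it holds for all $z\in\Pi^2$ large enough satisfying $\|z\|\le c\,\min\{\mathrm{Im}(z_1),\mathrm{Im}(z_2)\}$ (i.e. the $o$ or $O$ estimate holds as $\|z\|\to\infty$ within this region, for each $c$). Löwner class $\mathcal{L}^N$: the set of $h\in\mathcal{P}_2$ such that $\lim_{s\to\infty}h(is,is)=0$ and there are real numbers $(\rho_n)_{|n|\le 2N-1}$ with $h(z)=\sum_{|n|\le 2N-1}\frac{\rho_n}{z^n}+o\left(\frac{1}{\|z\|^{2N-1}}\right)$ nontangentially. Intermediate Löwner class $\mathcal{L}^{N-}$: the set of $h\in\mathcal{P}_2$ such that $\lim_{s\to\infty}h(is,is)=0$ and there are real numbers $(\rho_n)_{|n|\le 2N-2}$ with $h(z)=\sum_{|n|\le 2N-2}\frac{\rho_n}{z^n}+O\left(\frac{1}{\|z\|^{2N-1}}\right)$ nontangentially. *)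

(* Defs.v *)
From HB Require Import structures.
From mathcomp Require Import all_boot all_order all_algebra.
From mathcomp Require Import all_classical all_reals all_analysis.
From mathcomp Require Import complex.

Set Implicit Arguments.
Unset Strict Implicit.
Unset Printing Implicit Defensive.

Import Order.TTheory GRing.Theory Num.Theory.
Import numFieldNormedType.Exports.

Local Open Scope classical_set_scope.
Local Open Scope ring_scope.
Local Open Scope complex_scope.

Section LoewnerClasses.
Variable R : realType.
(* [R[i]^o] is [R[i]] regarded as a one-dimensional normed space over itself:
   [differentiable] on functions between such spaces is complex
   differentiability, with a C-linear differential. *)
Local Notation C := R[i]^o.

Implicit Types (h : C * C -> C) (z : C * C).

Definition upper_half_plane : set C := [set w | 0 < complex.Im w].

Local Notation Pi2 := (upper_half_plane `*` upper_half_plane).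

(* Functions on Pi^2 are encoded as total functions; only their values on the
   open set Pi^2 matter in the definitions below. *)
Definition pick2 : set (C * C -> C) :=
  [set h | forall z, Pi2 z -> differentiable h z /\ upper_half_plane (h z)].

Definition norm2 z : R :=
  Num.sqrt (Normc.normc z.1 ^+ 2 + Normc.normc z.2 ^+ 2).

(* Improper for small c (the region is then empty), so that Landau estimates
   along it hold vacuously. *)
Definition nontangential (c : R) : set_system (C * C) :=
  filter_from setT (fun M : R =>
    [set z | [/\ Pi2 z, M <= norm2 z
               & norm2 z <= c * Num.min (complex.Im z.1) (complex.Im z.2)]]).

Global Instance nontangential_filter (c : R) : Filter (nontangential c).
Proof.
apply: filter_from_filter; first by exists 0.
move=> M1 M2 _ _; exists (Num.max M1 M2) => // z [zPi].
by rewrite ge_max => /andP[M1z M2z] zc; split; split.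
Qed.

Canonical nontangential_filter_on (c : R) :=
  FilterType (nontangential c) (nontangential_filter c).

Definition inv_poly (d : nat) (rho : nat * nat -> R) z : C :=
  \sum_(n : 'I_d.+1 * 'I_d.+1 | (n.1 + n.2 <= d)%N)
    (rho (n.1 : nat, n.2 : nat))%:C / (z.1 ^+ n.1 * z.2 ^+ n.2).

Definition inv_norm (k : nat) z : C := ((norm2 z) ^- k)%:C.

Definition vanishes_at_infinity h : Prop :=
  h ((0 +i* s) : C, (0 +i* s) : C) @[s --> +oo%R] --> (0 : C).

(* The coefficients rho are chosen before the aperture c. *)
Definition loewner (N : nat) : set (C * C -> C) :=
  [set h | [/\ pick2 h, vanishes_at_infinity h &
    exists rho : nat * nat -> R, forall c : R,
      h = inv_poly (2 * N - 1)%N rho +o_ (nontangential c) inv_norm (2 * N - 1)%N]].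

Definition loewner_minus (N : nat) : set (C * C -> C) :=
  [set h | [/\ pick2 h, vanishes_at_infinity h &
    exists rho : nat * nat -> R, forall c : R,
      h = inv_poly (2 * N - 2)%N rho +O_ (nontangential c) inv_norm (2 * N - 1)%N]].

End LoewnerClasses.

(* Main.v *)
Require Import Defs.
From mathcomp Require Import all_boot all_order all_algebra.
From mathcomp Require Import all_classical all_reals all_analysis.
From mathcomp Require Import complex ring lra zify.

Set Implicit Arguments.
Unset Strict Implicit.
Unset Printing Implicit Defensive.

Import Order.TTheory GRing.Theory Num.Theory.
Import numFieldNormedType.Exports.

Local Open Scope classical_set_scope.
Local Open Scope ring_scope.
Local Open Scope complex_scope.

(** The two classes are separated by the continued fraction
      h_0 = - 1 / (z_1 + z_2),    h_(n+1) = - 1 / (z_1 + h_n),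
    with n = N - 1.  Since u |-> - 1 / u preserves the upper half plane, every
    h_n is a Pick function, and |h_n| <= 1 / Im z_1 ([pick_example_norm_le]).

    The function h_0 is homogeneous of degree -1, hence O(1 / |z|)
    nontangentially, but it is not a linear combination of 1 / z_1 and 1 / z_2.
    Each level of the fraction delays this defect by two orders: with
    x = 1 / z_1,
      h_n = p_n(x) + h_0 x^(2n) + O(1 / |z|^(2n+2))
    for a real polynomial p_n ([pick_example_expansion]).  For the induction
    step, write h_(n+1) = - x v with v = 1 / (1 + x h_n).  If S is an inverse of
    1 + x p_n(x) modulo a high power of x, then v - S is, up to higher order,
    - v S x (h_n - p_n(x)), whose leading term is - h_0 x^(2n+1); so p_(n+1) is
    - x S and the coefficient of the defect remains 1
    ([continued_fraction_step]).  Truncating p_n at degree 2n = 2N - 2 puts h_n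
    in the intermediate class.

    If h_n were in the smaller class, then h_0 x^(2n) would be a real polynomial
    of degree at most 2n + 1 in 1 / z_1 and 1 / z_2, up to
    o(1 / |z|^(2n+1)).  Restricted to a real ray, both sides become polynomials
    of degree at most 2n + 1 in the inverse of the parameter, so the two sides
    are equal on the whole of Pi^2 ([poly_littleo_eq0]).  At the points
    (i, i / x) with x > 0 this says that x / (1 + x) is a polynomial in x, which
    the pole at x = - 1 forbids ([inv_poly_not_asymptotic]). *)

Section Counterexample.
Variable R : realType.
Local Notation C := R[i]^o.
Local Notation Pi2 := (@upper_half_plane R `*` @upper_half_plane R).
Implicit Types (z : C * C).

(** * The continued fraction *)

Lemma Im_add (u v : R[i]) : complex.Im (u + v) = complex.Im u + complex.Im v.
Proof. by case: u v => [a b] [c d]. Qed.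

Lemma Im_gt0_neq0 (u : R[i]) : 0 < complex.Im u -> u != 0.
Proof. by case: u => a b /= b0; rewrite eq_complex /= negb_and (gt_eqF b0) orbT. Qed.

Lemma Im_oppV_gt0 (u : R[i]) : 0 < complex.Im u -> 0 < complex.Im (- u^-1).
Proof.
case: u => a b /= b0; rewrite opprK divr_gt0 //.
by rewrite ltr_wpDl ?sqr_ge0 ?exprn_gt0.
Qed.

Lemma Im_le_norm (u : R[i]) : 0 <= complex.Im u -> (complex.Im u)%:C <= `|u|.
Proof.
case: u => a b /= b0; rewrite normc_def lecR /=.
rewrite -[leLHS](ger0_norm b0) -sqrtr_sqr ler_sqrt ?lerDr ?sqr_ge0 //.
by rewrite addr_ge0 ?sqr_ge0.
Qed.

Lemma normr_normc (u : R[i]) : `|u| = (Normc.normc u)%:C.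
Proof. by case: u => a b; rewrite normc_def. Qed.

Fixpoint pick_example (n : nat) : C * C -> C :=
  if n is m.+1 then fun z => - (z.1 + pick_example m z)^-1
  else fun z => - (z.1 + z.2)^-1.

Lemma fst_differentiable z : differentiable (fst : C * C -> C) z.
Proof. by apply: linear_differentiable => ?; exact: cvg_fst. Qed.

Lemma snd_differentiable z : differentiable (snd : C * C -> C) z.
Proof. by apply: linear_differentiable => ?; exact: cvg_snd. Qed.

Lemma differentiable_oppV_fstD (f : C * C -> C) z :
  differentiable f z -> z.1 + f z != 0 ->
  differentiable (fun y => - (y.1 + f y)^-1 : C) z.
Proof.
move=> df nz.
apply: differentiableN; apply: differentiableV => //.
by apply: differentiableD => //; exact: fst_differentiable.
Qed.

Lemma pick_example_Im_gt0 n z : Pi2 z -> 0 < complex.Im (pick_example n z).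
Proof.
rewrite /upper_half_plane /=; move=> [z1 z2].
elim: n => [|n IH] /=; apply: Im_oppV_gt0; rewrite Im_add addr_gt0 //.
Qed.

(** Every denominator of the continued fraction has positive imaginary part on
    Pi^2, so it does not vanish there. *)
Lemma pick_example_pick2 n : pick2 (pick_example n).
Proof.
move=> z zP; split; last exact: pick_example_Im_gt0.
elim: n => [|n IH] /=; apply: differentiable_oppV_fstD => //.
- exact: snd_differentiable.
- by apply: Im_gt0_neq0; case: zP => ? ?; rewrite Im_add addr_gt0.
- apply: Im_gt0_neq0; case: (zP) => ? ?; rewrite Im_add addr_gt0 //.
  exact: pick_example_Im_gt0.
Qed.

(** |u + v| >= Im (u + v) >= Im u. *)
Lemma norm_oppV_le (u v : R[i]) : 0 < complex.Im u -> 0 <= complex.Im v ->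
  `|- (u + v)^-1| <= ((complex.Im u)^-1)%:C.
Proof.
move=> u0 v0; have uv0 : 0 < complex.Im (u + v) by rewrite Im_add ltr_wpDr.
rewrite normrN normfV -[(_^-1)%:C]/(real_complex R _) fmorphV lef_pV2; last 2 first.
- by rewrite posrE normr_gt0 Im_gt0_neq0.
- by rewrite posrE ltcR.
apply: le_trans (Im_le_norm (ltW uv0)).
by rewrite lecR Im_add lerDl.
Qed.

(** This one estimate, uniform in n, gives the limit 0 along the imaginary
    diagonal and, as Im z_1 is at least |z| / c in a nontangential region, the
    nontangential order 1 / |z|. *)
Lemma pick_example_norm_le n z : Pi2 z ->
  `|pick_example n z| <= ((complex.Im z.1)^-1)%:C.
Proof.
case: n => [|n] zP /=; case: (zP) => z1 z2;
  apply: norm_oppV_le => //; apply: ltW => //.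
exact: pick_example_Im_gt0.
Qed.

Lemma pick_example_vanishes n : vanishes_at_infinity (pick_example n).
Proof.
rewrite /vanishes_at_infinity.
apply/cvgr0Pnorm_le => e e0 /=.
have [r er] : exists r, e = r%:C.
  by exists (complex.Re e); rewrite RRe_real ?gtr0_real.
move: e0; rewrite er ltcR => r0.
have rV0 : 0 < r^-1 by rewrite invr_gt0.
apply: filterS (nbhs_pinfty_ge (num_real r^-1)) => s rs.
have s0 : 0 < s := lt_le_trans rV0 rs.
apply: le_trans (pick_example_norm_le _ _) _ => //=.
by rewrite lecR invf_ple.
Qed.

(** * Nontangential orders of magnitude *)

(** O(1 / |z|^k) in every nontangential region, with a constant that may depend
    on the aperture. *)
Definition decays (k : nat) (f : C * C -> C) := forall c : R,
  exists2 B : R[i], 0 <= B &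
    \forall z \near nontangential c, `|f z| <= B * inv_norm k z.

Lemma near_nontangential c (P : C * C -> Prop) :
  (\forall z \near nontangential c, P z) <->
  exists M : R, forall z, Pi2 z -> M <= norm2 z ->
    norm2 z <= c * Num.min (complex.Im z.1) (complex.Im z.2) -> P z.
Proof.
split=> [[M _ MP]|[M MP]].
  by exists M => z zP Mz cz; apply: MP.
by exists M => // z [zP Mz cz]; apply: MP.
Qed.

Lemma near_nontangential_norm2_ge c (M : R) :
  \forall z \near nontangential c, M <= norm2 z.
Proof. by apply/near_nontangential; exists M. Qed.

Lemma near_nontangential_Pi2 c : \forall z \near nontangential c, Pi2 z.
Proof. by apply/near_nontangential; exists 0. Qed.

Lemma inv_norm_ge0 k z : 0 <= inv_norm k z :> R[i].
Proof. by rewrite /inv_norm ler0c invr_ge0 exprn_ge0 // sqrtr_ge0. Qed.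

Lemma inv_normD k l z : inv_norm (k + l) z = inv_norm k z * inv_norm l z :> R[i].
Proof. by rewrite /inv_norm -rmorphM /= exprD invfM. Qed.

Lemma inv_norm_le k l z : (k <= l)%N -> 1 <= norm2 z ->
  inv_norm l z <= inv_norm k z :> R[i].
Proof.
move=> kl z1; rewrite /inv_norm lecR.
rewrite lef_pV2 ?posrE ?exprn_gt0 ?(lt_le_trans ltr01) //.
exact: ler_weXn2l.
Qed.

Lemma decays_le k l f : (k <= l)%N -> decays l f -> decays k f.
Proof.
move=> kl fl c; have [B B0 Bf] := fl c; exists B => //.
near=> z; apply: le_trans (_ : B * inv_norm l z <= _); first by near: z.
apply: ler_wpM2l => //; apply: inv_norm_le => //; near: z.
exact: near_nontangential_norm2_ge.
Unshelve. all: end_near. Qed.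

Lemma decaysD k f g : decays k f -> decays k g -> decays k (f \+ g).
Proof.
move=> fk gk c; have [A A0 Af] := fk c; have [B B0 Bg] := gk c.
exists (A + B); first exact: addr_ge0.
near=> z; rewrite /= mulrDl; apply: le_trans (ler_normD _ _) _.
by apply: lerD; near: z.
Unshelve. all: end_near. Qed.

Lemma decaysM k l f g : decays k f -> decays l g -> decays (k + l) (f \* g).
Proof.
move=> fk gk c; have [A A0 Af] := fk c; have [B B0 Bg] := gk c.
exists (A * B); first exact: mulr_ge0.
near=> z; rewrite /= normrM inv_normD mulrACA.
by apply: ler_pM; rewrite ?normr_ge0 //; near: z.
Unshelve. all: end_near. Qed.

Lemma decaysB k f g : decays k f -> decays k g -> decays k (f \- g).
Proof.
move=> fk gk; apply: decaysD => // c; have [B B0 Bg] := gk c; exists B => //.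
by near=> z; rewrite normrN; near: z.
Unshelve. all: end_near. Qed.

Lemma decays_near k f g :
  (forall c, \forall z \near nontangential c, f z = g z) ->
  decays k f -> decays k g.
Proof.
move=> fg fk c; have [B B0 Bf] := fk c; exists B => //.
have fgc := fg c.
by near=> z; rewrite -(near fgc z) //; near: z.
Unshelve. all: end_near. Qed.

Lemma decays_cst a : decays 0 (fun=> a).
Proof.
move=> c; exists `|a|; first exact: normr_ge0.
by near=> z; rewrite /inv_norm expr0 invr1 mulr1.
Unshelve. all: end_near. Qed.

Lemma decays_imV (f : C * C -> C) :
  (forall z, Pi2 z -> `|f z| <= ((complex.Im z.1)^-1)%:C) -> decays 1 f.
Proof.
move=> fle c; exists `|c|%:C; first by rewrite ler0c.
apply/near_nontangential; exists 1 => z zP z1 zc.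
apply: le_trans (fle z zP) _; rewrite /inv_norm expr1 -rmorphM lecR.
have n0 := lt_le_trans ltr01 z1; case: (zP) => i1 i2.
rewrite -[leLHS]mul1r ler_pdivlMr // mulrAC ler_pdivrMr // mul1r.
apply: (le_trans zc); apply: ler_pM => //; last by rewrite ge_min lexx.
  by move: (lt_le_trans n0 zc); rewrite pmulr_lgt0 ?lt_min ?i1 // => /ltW.
  by rewrite le_min !ltW.
exact: ler_norm.
Qed.

(** |z_1| <= |z|. *)
Lemma decays_mul_fst k (f : C * C -> C) :
  decays k.+1 f -> decays k (fun z => z.1 * f z).
Proof.
move=> fk c; have [B B0 Bf] := fk c; exists B => //.
near=> z.
have z1 : 1 <= norm2 z by near: z; exact: near_nontangential_norm2_ge.
have fB : `|f z| <= B * inv_norm k.+1 z by near: z.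
have nz : `|z.1| <= (norm2 z)%:C.
  rewrite /norm2.
  rewrite normr_normc lecR; apply: le_trans (ler_norm _) _.
  by rewrite -sqrtr_sqr ler_wsqrtr // lerDl sqr_ge0.
rewrite normrM; apply: le_trans (ler_pM _ _ nz fB) _; rewrite ?normr_ge0 //.
rewrite mulrCA ler_wpM2l // /inv_norm -rmorphM /= exprS invfM mulVKf //.
by rewrite gt_eqF // (lt_le_trans ltr01).
Unshelve. all: end_near. Qed.

Lemma decays_inv_fst : decays 1 (fun z => z.1^-1 : C).
Proof.
apply: decays_imV => z [z1 _].
by rewrite -normrN -[z.1 in leLHS]addr0; exact: norm_oppV_le.
Qed.

Lemma decaysX k m (f : C * C -> C) :
  decays k f -> decays (k * m) (fun z => f z ^+ m).
Proof.
move=> fk; elim: m => [|m IH]; first by rewrite muln0; exact: decays_cst.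
by rewrite mulnS; apply: decays_near (decaysM fk IH) => c; near=> z; rewrite exprS.
Unshelve. all: end_near. Qed.

(** * The asymptotic expansion *)

Definition horner_inv_fst (p : {poly R}) z : C :=
  (map_poly (real_complex R) p).[z.1^-1].

Lemma horner_inv_fstE z :
  ((forall p q,
      (horner_inv_fst (p + q) z = horner_inv_fst p z + horner_inv_fst q z)%R) *
   (forall p q,
      (horner_inv_fst (p * q) z = horner_inv_fst p z * horner_inv_fst q z)%R) *
   (forall p, (horner_inv_fst (- p) z = - horner_inv_fst p z)%R) *
   (horner_inv_fst 0 z = 0) * (horner_inv_fst 1 z = 1) *
   (forall a, horner_inv_fst a%:P z = a%:C) *
   (horner_inv_fst 'X z = z.1^-1) *
   (forall k, (horner_inv_fst 'X^k z = z.1^-1 ^+ k)%R))%type.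
Proof.
rewrite /horner_inv_fst rmorph0 rmorph1 map_polyX hornerC hornerX; do !split=> //.
- by move=> p q; rewrite rmorphD hornerD.
- by move=> p q; rewrite rmorphM hornerM.
- by move=> p; rewrite rmorphN hornerN.
- by rewrite hornerC.
- by move=> a; rewrite map_polyC hornerC.
- by move=> k; rewrite map_polyXn hornerXn.
Qed.

Lemma decays_horner p : decays 0 (horner_inv_fst p).
Proof.
elim/poly_ind: p => [|p a IH].
  by apply: decays_near (decays_cst 0) => c; near=> z; rewrite horner_inv_fstE.
apply: (decays_near (f := fun z => horner_inv_fst p z * z.1^-1 + a%:C)).
  move=> c; near=> z.
  by rewrite !horner_inv_fstE.
apply: decaysD; last exact: decays_cst.
apply: (decays_le (l := 0 + 1)) => //; apply: decaysM => //.
exact: decays_inv_fst.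
Unshelve. all: end_near. Qed.

(** 1 + X A has constant term 1, so it is invertible modulo X^(k+1).  The inverse
    S itself has constant term 1, which fixes the coefficient of the first
    nonpolynomial term in the expansion below. *)
Lemma poly_inverse_mod_Xn (A : {poly R}) (k : nat) :
  exists S S1 T : {poly R},
    S * (1 + 'X * A) = 1 + 'X^(k.+1) * T /\ S = 1 + 'X * S1.
Proof.
elim: k => [|k [S [S1 [T [ST S1E]]]]].
  by exists 1, 0, A; rewrite mul1r expr1 mulr0 addr0.
(* Newton step: (1 + X^(k+1) T) (1 - X^(k+1) T) = 1 - X^(2k+2) T^2. *)
exists (S * (1 - 'X^(k.+1) * T)), (S1 - S * 'X^k * T), (- 'X^k * T ^+ 2); split.
  by rewrite mulrAC ST !exprS; ring.
by rewrite mulrBr mulr1 {1}S1E exprS; ring.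
Qed.

(** The algebra of the induction step.  Here x = 1 / z_1, y = x^(2n), h = h_n and
    w = h_0, so that v = 1 / (1 + x h) and h_(n+1) = - x v; A is the value of
    p_n, and S, S1, T are those of the polynomials of [poly_inverse_mod_Xn].
    Each of the three terms on the right has order at least 2n + 4: the first
    comes from the inexact inversion, the second from the remainder of h_n, the
    third from the factor v S of the defect, which is 1 + O(x). *)
Lemma continued_fraction_step (F : comNzRingType) (x y h w v A S S1 T : F) :
  v * (1 + x * h) = 1 -> S * (1 + x * A) = 1 + x ^+ 3 * y * T ->
  S = 1 + x * S1 ->
  - (x * v) + x * S - w * (x ^+ 2 * y) =
    x ^+ 4 * y * (v * T) + x ^+ 2 * (v * S * (h - A - w * y)) +
    w * (x ^+ 3 * y) * (v * (S1 - h)).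
Proof.
move=> Ev ET ES; apply/eqP; rewrite -subr_eq0; apply/eqP.
(* The combination of the three hypotheses that yields the difference. *)
transitivity (- (x * S - x ^+ 2 * y * w) * (v * (1 + x * h) - 1) +
  x * v * (S * (1 + x * A) - (1 + x ^+ 3 * y * T)) +
  x ^+ 2 * y * w * v * (S - (1 + x * S1))); first by ring.
by rewrite Ev ET -ES !subrr !mulr0 !addr0.
Qed.

(** As z_1 and z_2 have the same order as |z|, the term h_0 x^(2n) has exact order
    2n + 1: it is the first term that is not a polynomial in 1 / z_1. *)
Lemma pick_example_expansion n : exists p : {poly R},
  decays (2 * n).+2
    (fun z => pick_example n z - horner_inv_fst p z
              - pick_example 0 z * z.1^-1 ^+ (2 * n)).
Proof.
elim: n => [|n [A He]].
  exists 0 => c; exists 0 => //; near=> z.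
  by rewrite horner_inv_fstE subr0 expr0 mulr1 subrr normr0 mul0r.
have [S [S1 [T [ST S1E]]]] := poly_inverse_mod_Xn A (2 * n).+2.
have dh m : decays 1 (pick_example m).
  by apply: decays_imV => z; exact: pick_example_norm_le.
(* v = 1 / (1 + h_n / z_1), written so that its boundedness is apparent. *)
pose v z := - (z.1 * pick_example n.+1 z).
have dv : decays 0 v.
  have := decaysM (decays_cst (-1)) (decays_mul_fst (dh n.+1)).
  by apply: decays_near => c; near=> z; rewrite /v /= mulN1r.
have dp := decays_horner.
have dx m := decaysX m decays_inv_fst.
exists (- 'X * S).
(* The three error terms of continued_fraction_step. *)
have d1 : decays (2 * n.+1).+2
    (fun z => z.1^-1 ^+ (2 * n).+4 * (v z * horner_inv_fst T z)).
  have := decaysM (dx (2 * n).+4) (decaysM dv (dp T)).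
  by apply: decays_le; lia.
have d2 : decays (2 * n.+1).+2 (fun z => z.1^-1 ^+ 2 * (v z * horner_inv_fst S z *
     (pick_example n z - horner_inv_fst A z
      - pick_example 0 z * z.1^-1 ^+ (2 * n)))).
  have := decaysM (dx 2) (decaysM (decaysM dv (dp S)) He).
  by apply: decays_le; lia.
have d3 : decays (2 * n.+1).+2 (fun z => pick_example 0 z * z.1^-1 ^+ (2 * n).+3 *
     (v z * (horner_inv_fst S1 z - pick_example n z))).
  have := decaysM (decaysM (dh 0) (dx (2 * n).+3))
    (decaysM dv (decaysB (dp S1) (decays_le (leq0n 1) (dh n)))).
  by apply: decays_le; lia.
apply: decays_near (decaysD (decaysD d1 d2) d3) => c.
near=> z.
have zP : Pi2 z by near: z; exact: near_nontangential_Pi2.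
have z0 : z.1 != 0 by case: zP => i1 _; exact: Im_gt0_neq0.
have zh0 : z.1 + pick_example n z != 0.
  apply: Im_gt0_neq0; rewrite Im_add; case: (zP) => i1 _.
  by rewrite addr_gt0 // pick_example_Im_gt0.
apply/esym.
have := @continued_fraction_step _ z.1^-1 (z.1^-1 ^+ (2 * n))
  (pick_example n z) (pick_example 0 z) (v z) (horner_inv_fst A z)
  (horner_inv_fst S z) (horner_inv_fst S1 z) (horner_inv_fst T z).
have hE := congr1 (fun p => horner_inv_fst p z).
rewrite -!exprD => step.
transitivity (- (z.1^-1 * v z) + z.1^-1 * horner_inv_fst S z
   - pick_example 0 z * z.1^-1 ^+ (2 + 2 * n)).
  rewrite mulnS; congr (_ + _ - _).
    by rewrite /v mulrN opprK mulKf.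
  by rewrite !horner_inv_fstE mulNr opprK.
apply: step.
- rewrite /v -[pick_example n.+1 z]/(- (z.1 + pick_example n z)^-1) mulrN opprK.
  have -> : 1 + z.1^-1 * pick_example n z = z.1^-1 * (z.1 + pick_example n z).
    by rewrite mulrDr mulVf.
  by rewrite mulrACA mulfV // mul1r mulVf.
- by have := hE _ _ ST; rewrite !horner_inv_fstE.
- by have := hE _ _ S1E; rewrite !horner_inv_fstE.
Unshelve. all: end_near. Qed.

(** * Membership in the intermediate class *)

(** A polynomial in 1 / z_1 as a family of coefficients supported on the first
    axis of multi-indices. *)
Definition axis_coef (p : {poly R}) (m : nat * nat) : R :=
  if m.2 == 0%N then p`_m.1 else 0.

Lemma inv_poly_axis d p z :
  inv_poly d (axis_coef p) z = horner_inv_fst (take_poly d.+1 p) z.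
Proof.
rewrite /inv_poly /horner_inv_fst big_mkcond /=.
rewrite -(pair_bigA _ (fun i j : 'I_d.+1 => if (i + j <= d)%N then
  (axis_coef p (i : nat, j : nat))%:C / (z.1 ^+ i * z.2 ^+ j) else 0)) /=.
rewrite (@horner_coef_wide _ d.+1); last first.
  by rewrite (leq_trans (size_poly _ _)) // size_take_poly.
apply: eq_bigr => i _; rewrite (bigD1 ord0) //= big1 => [|j j0].
  rewrite addn0 -ltnS ltn_ord /axis_coef /= addr0 expr0 mulr1 exprVn.
  by rewrite coef_map coef_take_poly ltn_ord.
by rewrite /axis_coef /= -[_ == 0%N]/(j == ord0) (negbTE j0) rmorph0 mul0r if_same.
Qed.

(** The discarded terms are divisible by 1 / z_1^(d+1). *)
Lemma decays_inv_poly_axis d p :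
  decays d.+1 (fun z => horner_inv_fst p z - inv_poly d (axis_coef p) z).
Proof.
have := decaysM (decaysX d.+1 decays_inv_fst) (decays_horner (drop_poly d.+1 p)).
rewrite mul1n addn0; apply: decays_near => c; near=> z.
rewrite inv_poly_axis -{2}[p](poly_take_drop d.+1) !horner_inv_fstE.
by rewrite addrC addKr mulrC.
Unshelve. all: end_near. Qed.

Lemma pick_example_loewner_minus N : (1 <= N)%N ->
  loewner_minus N (pick_example N.-1 : C * C -> C).
Proof.
case: N => // n _ /=; split; first exact: pick_example_pick2.
  exact: pick_example_vanishes.
have [p dp] := pick_example_expansion n.
have -> : (2 * n.+1 - 2 = 2 * n)%N by lia.
have -> : (2 * n.+1 - 1 = (2 * n).+1)%N by lia.
exists (axis_coef p) => c.
have d : decays (2 * n).+1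
    (fun z => pick_example n z - inv_poly (2 * n) (axis_coef p) z).
  have d0 : decays 1 (pick_example 0 : C * C -> C).
    by apply: decays_imV => z; exact: pick_example_norm_le.
  have dw := decaysM d0 (decaysX (2 * n) decays_inv_fst).
  rewrite mul1n in dw.
  have := decaysD (decaysD (decays_le (leqnSn _) dp)
    (decays_inv_poly_axis (2 * n) p)) dw.
  apply: decays_near => c'; near=> z => /=; ring.
apply/eqaddOP/bigO_exP; have [B B0 Bd] := d c.
exists (B + 1); first by rewrite ltr_wpDl.
near=> z; rewrite [X in _ <= _ * X]ger0_norm ?inv_norm_ge0 //.
apply: le_trans (_ : B * inv_norm (2 * n).+1 z <= _); first by near: z.
by rewrite ler_wpM2r ?inv_norm_ge0 // lerDl.
Unshelve. all: end_near. Qed.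

(** * Exclusion from the smaller class *)

(** o(1 / |z|^k) in every nontangential region. *)
Definition negligible (k : nat) (f : C * C -> C) := forall (c e : R), 0 < e ->
  \forall z \near nontangential c, `|f z| <= e%:C * inv_norm k z.

Lemma decays_negligible k f : decays k.+1 f -> negligible k f.
Proof.
move=> fk c e e0; have [B B0 Bf] := fk c.
have [r r0 Br] : exists2 r : R, 0 <= r & B = r%:C.
  exists (complex.Re B); last by rewrite RRe_real ?ger0_real.
  by move: B0; rewrite lecE => /andP[].
near=> z.
have zr : r / e <= norm2 z by near: z; exact: near_nontangential_norm2_ge.
have z1 : 1 <= norm2 z by near: z; exact: near_nontangential_norm2_ge.
apply: le_trans (_ : B * inv_norm k.+1 z <= _); first by near: z.
rewrite -addn1 inv_normD mulrCA mulrC ler_wpM2r ?inv_norm_ge0 //.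
rewrite /inv_norm Br -rmorphM lecR expr1.
by rewrite ler_pdivrMr ?(lt_le_trans ltr01) // mulrC -ler_pdivrMr.
Unshelve. all: end_near. Qed.

Lemma negligibleB k f g : negligible k f -> negligible k g -> negligible k (f \- g).
Proof.
move=> fk gk c e e0; have e2 : 0 < e / 2 by rewrite divr_gt0.
have fe := fk c _ e2; have ge := gk c _ e2.
near=> z; rewrite /= [e]splitr rmorphD mulrDl; apply: le_trans (ler_normB _ _) _.
by apply: lerD; near: z.
Unshelve. all: end_near. Qed.

(** With x at most |u| / (2K), the bound reads |u| <= |u| / 2. *)
Lemma eq0_le_small (u : R[i]) (K x0 : R) : 0 < x0 ->
  (forall x : R, 0 < x -> x <= x0 -> `|u| <= (K * x)%:C) -> u = 0.
Proof.
move=> x00 Ku; apply/eqP; rewrite -normr_le0.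
have [r ur] : exists r : R, `|u| = r%:C by rewrite normc_def; eexists.
rewrite ur lecR; have {}Ku x : 0 < x -> x <= x0 -> r <= K * x.
  by move=> *; rewrite -lecR -ur Ku.
rewrite leNgt; apply/negP => r0.
have K0 : 0 < K by have := lt_le_trans r0 (Ku x0 x00 (lexx _)); rewrite pmulr_lgt0.
have m0 : 0 < Num.min x0 (r / K / 2) by rewrite lt_min x00 !divr_gt0.
have := Ku _ m0; rewrite ge_min lexx => /(_ isT).
apply/negP; rewrite -ltNge.
apply: (@le_lt_trans _ _ (K * (r / K / 2))).
  by rewrite ler_pM2l // ge_min lexx orbT.
by rewrite mulrA mulrCA mulfV ?gt_eqF // mulr1; lra.
Qed.

Lemma horner_norm_le (p : {poly R[i]}) : exists B : R,
  0 <= B /\ forall x : R, 0 < x -> x <= 1 -> `|p.[x%:C]| <= B%:C.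
Proof.
elim/poly_ind: p => [|p a [B [B0 IH]]].
  by exists 0; split=> // x _ _; rewrite horner0 normr0.
have [r ar] : exists r : R, `|a| = r%:C by rewrite normc_def; eexists.
exists (B + r); split; first by rewrite addr_ge0 // -ler0c -ar normr_ge0.
move=> x x0 x1; rewrite hornerMXaddC (le_trans (ler_normD _ _)) // ar rmorphD lerD2r.
rewrite normrM -[leRHS]mulr1 ler_pM ?normr_ge0 ?IH //.
by rewrite ger0_norm ?ler0c ?(ltW x0) // -(rmorph1 (real_complex R)) lecR.
Qed.

(** A polynomial of degree at most d that is o(x^d) as x tends to 0 from the right
    vanishes: its constant term is its limit at 0, and dividing by x lowers
    d. *)
Lemma poly_littleo_eq0 d (p : {poly R[i]}) : (size p <= d.+1)%N ->
  (forall e : R, 0 < e -> exists2 x0 : R, 0 < x0 &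
     forall x : R, 0 < x -> x <= x0 -> `|p.[x%:C]| <= (e * x ^+ d)%:C) ->
  p = 0.
Proof.
elim: d p => [|d IH] p; elim/poly_ind: p => [//|p a _] sp po.
  have [p0 a0] : p = 0 /\ a = 0.
    move: sp; rewrite size_MXaddC; case: eqP => [p0|/eqP]; last first.
      by rewrite -size_poly_gt0; case: (size p).
    move=> _; split=> //; apply: (@eq0_le_small _ 1 1) => // x x0 _.
    have [x1 x10 /(_ x1 x10 (lexx _))] := po x x0.
    by rewrite p0 hornerMXaddC horner0 mul0r add0r expr0 mulr1 mul1r.
  by rewrite p0 a0 mul0r add0r.
have sp' : (size p <= d.+1)%N.
  move: sp; rewrite size_MXaddC; case: eqP => [->|_]; first by rewrite size_poly0.
  by [].
have [B [B0 pB]] := horner_norm_le p.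
have a0 : a = 0.
  have [x0 x00 px] := po 1 ltr01.
  apply: (@eq0_le_small _ (1 + B) (Num.min x0 1)); first by rewrite lt_min x00 /=.
  move=> x x_gt0; rewrite le_min => /andP[xx0 x1].
  have := px x x_gt0 xx0; rewrite hornerMXaddC.
  set u := p.[x%:C] * x%:C => h.
  have : `|a| <= `|u + a| + `|u|.
    by rewrite -{1}[a](addKr u) (addrC (- u)) ler_normB.
  move=> /le_trans; apply; rewrite mulrDl rmorphD lerD //.
    apply: le_trans h _; rewrite lecR !mul1r exprS.
    by rewrite ler_piMr ?exprn_ile1 // ltW.
  rewrite normrM rmorphM ler_pM ?normr_ge0 ?pB //.
  by rewrite ger0_norm ?ler0c ?(ltW x_gt0).
rewrite a0 addr0 (IH p) ?mul0r // => e e0.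
have [x0 x00 px] := po e e0; exists x0 => // x x_gt0 xx0.
have := px x x_gt0 xx0; rewrite hornerMXaddC a0 addr0 normrM.
rewrite [`|x%:C|]ger0_norm ?ler0c ?(ltW x_gt0) // exprS.
rewrite mulrCA mulrC rmorphM ler_pM2l //.
by rewrite ltcR.
Qed.

(** The ray is parametrized by the inverse of the dilation factor, so that
    infinity corresponds to x = 0 and [inv_poly] becomes a polynomial in x. *)
Definition ray z (x : R) : C * C := (z.1 / x%:C, z.2 / x%:C).

Lemma Im_divr (u : R[i]) (x : R) : complex.Im (u / x%:C) = complex.Im u / x.
Proof.
rewrite -[x%:C]/(real_complex R x) -fmorphV.
by case: u => a b /=; rewrite mulr0 add0r.
Qed.

Lemma norm2_ray z (x : R) : 0 < x -> norm2 (ray z x) = norm2 z / x.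
Proof.
move=> x0; rewrite /norm2 /ray /= !Normc.normcM !Normc.normcV.
have -> : Normc.normc x%:C = x.
  by rewrite /= expr0n /= addr0 sqrtr_sqr gtr0_norm.
rewrite !exprMn -mulrDl sqrtrM ?addr_ge0 ?sqr_ge0 // sqrtr_sqr gtr0_norm //.
by rewrite invr_gt0.
Qed.

Lemma inv_norm_ray z (x : R) k : 0 < x ->
  inv_norm k (ray z x) = (x ^+ k)%:C * inv_norm k z.
Proof.
move=> x0; rewrite /inv_norm -rmorphM norm2_ray //.
by rewrite exprMn invfM exprVn invrK mulrC.
Qed.

(** A ray from the origin inside Pi^2 lies in the nontangential region whose
    aperture is |z| / min (Im z_1, Im z_2). *)
Lemma negligible_ray k f z : Pi2 z -> negligible k f ->
  forall e : R, 0 < e -> exists2 x0 : R, 0 < x0 &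
    forall x : R, 0 < x -> x <= x0 -> `|f (ray z x)| <= (e * x ^+ k)%:C.
Proof.
move=> zP fk e e0; case: (zP) => i1 i2.
have n0 : 0 < norm2 z.
  rewrite /norm2 sqrtr_gt0 ltr_wpDr ?sqr_ge0 // exprn_gt0 //.
  by rewrite -ltcR -normr_normc normr_gt0 Im_gt0_neq0.
have m0 : 0 < Num.min (complex.Im z.1) (complex.Im z.2) by rewrite lt_min i1 i2.
have e1 : 0 < e * norm2 z ^+ k by rewrite mulr_gt0 ?exprn_gt0.
have /near_nontangential [M MP] :=
  fk (norm2 z / Num.min (complex.Im z.1) (complex.Im z.2)) _ e1.
have M0 : 0 < Num.max M 1 by rewrite lt_max ltr01 orbT.
exists (norm2 z / Num.max M 1); first exact: divr_gt0.
move=> x x0 xM; apply: le_trans (MP _ _ _ _) _.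
- by split; rewrite /upper_half_plane /= Im_divr divr_gt0.
- rewrite norm2_ray // ler_pdivlMr //; apply: (@le_trans _ _ (Num.max M 1 * x)).
    by rewrite ler_wpM2r ?(ltW x0) // le_max lexx.
  by rewrite mulrC -ler_pdivlMr.
- rewrite norm2_ray // /ray /= !Im_divr.
  rewrite -[leLHS]mulrC -minr_pMl ?invr_ge0 ?(ltW x0) //.
  by rewrite mulrA divfK ?gt_eqF // mulrC.
rewrite inv_norm_ray // /inv_norm -!rmorphM lecR.
by rewrite mulrACA mulfV ?mulr1 // gt_eqF // exprn_gt0.
Qed.

Definition ray_poly d (rho : nat * nat -> R) z : {poly R[i]} :=
  \sum_(n : 'I_d.+1 * 'I_d.+1 | (n.1 + n.2 <= d)%N)
    ((rho (n.1 : nat, n.2 : nat))%:C / (z.1 ^+ n.1 * z.2 ^+ n.2))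
      *: 'X^(n.1 + n.2).

Lemma size_ray_poly d rho z : (size (ray_poly d rho z) <= d.+1)%N.
Proof.
apply: (leq_trans (size_sum _ _ _)); apply/bigmax_leqP => m mn.
by rewrite (leq_trans (size_scale_leq _ _)) // size_polyXn.
Qed.

Lemma inv_poly_ray d rho z (x : R) :
  inv_poly d rho (ray z x) = (ray_poly d rho z).[x%:C].
Proof.
rewrite horner_sum; apply: eq_bigr => n _; rewrite hornerZ hornerXn /ray /=.
by rewrite !exprMn [X in _ / X = _]mulrACA invfM mulrA -exprD exprVn invrK.
Qed.

(** The ray polynomial vanishes; its value at x = 1 is f z. *)
Lemma negligible_ray_eq0 k f z (p : {poly R[i]}) : Pi2 z -> negligible k f ->
  (size p <= k.+1)%N -> (forall x : R, 0 < x -> f (ray z x) = p.[x%:C]) ->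
  f z = 0.
Proof.
move=> zP fk sp fp; have p0 : p = 0.
  apply: (poly_littleo_eq0 sp) => e e0.
  have [x0 x00 fx] := negligible_ray zP fk e0; exists x0 => // x x_gt0 xx0.
  by rewrite -fp // fx.
have := fp 1 ltr01; rewrite p0 horner0 /ray !divr1.
by case: z {zP fp}.
Qed.

(** Both functions restrict to polynomials of degree at most 2n + 1 on rays, so
    the estimate would force equality on Pi^2, and the restriction to the points
    (i, i / x) contradicts the pole of x / (1 + x) at - 1. *)
Lemma inv_poly_not_asymptotic n rho :
  ~ negligible (2 * n).+1 (inv_poly (2 * n).+1 rho \-
      (fun z => pick_example 0 z * z.1^-1 ^+ (2 * n))).
Proof.
set f := (_ \- _) => neg.
have E z : Pi2 z -> inv_poly (2 * n).+1 rho z = pick_example 0 z * z.1^-1 ^+ (2 * n).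
  move=> zP; apply/eqP; rewrite -subr_eq0; apply/eqP; rewrite -[LHS]/(f z).
  pose b := pick_example 0 z * z.1^-1 ^+ (2 * n).
  apply: (negligible_ray_eq0
    (p := ray_poly (2 * n).+1 rho z - b *: 'X^((2 * n).+1)) zP neg).
    rewrite (leq_trans (size_polyD _ _)) // geq_max size_polyN size_ray_poly /=.
    by rewrite (leq_trans (size_scale_leq _ _)) // size_polyXn.
  move=> x x0; rewrite /f /= inv_poly_ray hornerD hornerN hornerZ hornerXn.
  congr (_ - _); rewrite /b /ray /= -mulrDl invfM invrK invfM invrK exprMn exprS -mulNr; ring.
have i0 : 'i%C != 0 :> R[i] by rewrite eq_complex /= oner_eq0 andbF.
(* At (i, i / x) the two sides are g(x) and - a x / (x + 1), so p vanishes on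
   the positive reals; but p(- 1) = - a is nonzero. *)
pose g : {poly R[i]} :=
  \sum_(m : 'I_(2 * n).+2 * 'I_(2 * n).+2 | (m.1 + m.2 <= (2 * n).+1)%N)
    ((rho (m.1 : nat, m.2 : nat))%:C / 'i%C ^+ (m.1 + m.2)) *: 'X^(m.2).
pose a : R[i] := 'i%C^-1 ^+ (2 * n).+1.
pose p : {poly R[i]} := g * ('X + 1) + a *: 'X.
have px (x : R) : 0 < x -> p.[x%:C] = 0.
  move=> x0.
  have x0' : x%:C != 0 by rewrite gt_eqF // ltcR.
  pose z : C * C := ('i%C, 'i%C / x%:C).
  have zP : Pi2 z.
    have i2 : 0 < complex.Im ('i%C / x%:C : R[i]).
      by rewrite Im_divr divr_gt0 // ltr01.
    by split; [exact: ltr01 | exact: i2].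
  have gE : inv_poly (2 * n).+1 rho z = g.[x%:C].
    rewrite horner_sum; apply: eq_bigr => m _; rewrite hornerZ hornerXn /=.
    by rewrite exprMn mulrA -exprD invfM mulrA exprVn invrK.
  have x1 : x%:C + 1 != 0 by rewrite gt_eqF // ltr_wpDr // ltcR.
  rewrite /p hornerD hornerM hornerD hornerX hornerC hornerZ hornerX -gE E //=.
  rewrite /a exprS; set b := _ ^+ (2 * n).
  have -> : 'i%C + 'i%C / x%:C = 'i%C * (x%:C + 1) / x%:C :> R[i] by field.
  by field; rewrite i0 x1 x0'.
have p0 : p = 0.
  apply: (@poly_littleo_eq0 (size p)) => // e e0; exists 1 => // x x0 _.
  by rewrite px // normr0 ler0c mulr_ge0 ?exprn_ge0 // ltW.
have := congr1 (fun p => p.[-1]) p0.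
rewrite /p hornerD hornerM hornerD hornerX hornerC addNr mulr0 add0r.
rewrite hornerZ hornerX horner0.
by apply/eqP; rewrite mulf_neq0 ?oppr_eq0 ?oner_neq0 // expf_neq0 // invr_neq0.
Qed.

Lemma inv_polyB d rho rho' z : inv_poly d rho z - inv_poly d rho' z =
  inv_poly d (fun m => rho m - rho' m) z :> R[i].
Proof.
by rewrite /inv_poly -sumrB; apply: eq_bigr => m _; rewrite rmorphB mulrBl.
Qed.

(** Subtracting two candidate expansions of order 2n + 1 leaves a polynomial in
    1 / z_1 and 1 / z_2 equal to h_0 x^(2n) up to o(1 / |z|^(2n+1)). *)
Lemma pick_example_not_loewner N : (1 <= N)%N ->
  ~ loewner N (pick_example N.-1 : C * C -> C).
Proof.
case: N => // n _ /=; have [p dp] := pick_example_expansion n.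
move=> [_ _ [rho]]; have -> : (2 * n.+1 - 1 = (2 * n).+1)%N by lia.
move=> hrho.
have n1 : negligible (2 * n).+1 (pick_example n \- inv_poly (2 * n).+1 rho).
  move=> c e e0; move/eqaddoP: (hrho c) => /(_ e%:C).
  rewrite ltcR => /(_ e0); apply: filterS => z.
  by rewrite [X in _ <= _ * X -> _]ger0_norm ?inv_norm_ge0.
have n2 := decays_negligible (decaysD dp (decays_inv_poly_axis (2 * n).+1 p)).
apply: (@inv_poly_not_asymptotic n (fun m => rho m - axis_coef p m)).
move=> c e e0; apply: filterS (negligibleB n2 n1 c e0) => z.
rewrite /= -inv_polyB; congr (`|_| <= _); ring.
Qed.

End Counterexample.

Theorem mainTheorem3 (R : realType) (N : nat) (hN : (1 <= N)%N) :
  @loewner R N <> @loewner_minus R N.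
Proof.
move=> eqL; apply: (@pick_example_not_loewner R N hN).
by rewrite eqL; exact: pick_example_loewner_minus.
Qed.
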